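(* Let $A$ be an algebra of the variety $\mathcal{V}$ such that $K(A)$ is closed under the commutator operation. Then: (1) for any congruence $\theta$ of $A$ we have $(\widetilde{Ker}(\theta))^{\ast}=\sigma(\theta^{\ast})$; (2) for any ideal $I$ of $L(A)$ we have $(\sigma(I))_{\ast}=\widetilde{Ker}(I_{\ast})$; (3) if $A$ is semiprime, then for all $\theta\in Con(A)$ and all ideals $I$ of $L(A)$ we have $(Ker(\theta))^{\ast}=\sigma(\theta^{\ast})$ and $(\sigma(I))_{\ast}=Ker(I_{\ast})$.
   Context: $\mathcal{V}$ is a fixed congruence-modular variety of algebras (of a finite signature) that is semidegenerate: no nontrivial algebra in $\mathcal{V}$ has one-element subalgebras (equivalently, $\nabla_A$ is compact in $Con(A)$ for every $A\in\mathcal{V}$). For $A\in\mathcal{V}$, $Con(A)$ is the complete lattice of congruences of $A$, with least element $\Delta_A$ and greatest element $\nabla_A$; $K(A)$ is the set of compact (= finitely generated) congruences. Commutator: $[\cdot,\cdot]=[\cdot,\cdot]_A$ is the (modular) commutator, i.e. the greatest operation on the congruence lattices of members of $\mathcal{V}$ such that for every surjective morphism $f:A\to B$ in $\mathcal{V}$ and all $\alpha,\beta\in Con(A)$: $[\alpha,\beta]_A\subseteq\alpha\cap\beta$ and $[\alpha,\beta]_A\vee Ker(f)=f^{-1}([f(\alpha\vee Ker(f)),f(\beta\vee Ker(f))]_B)$. Residuation: $\alpha\rightarrow\beta=\bigvee\{\gamma\in Con(A)\mid[\alpha,\gamma]\subseteq\beta\}$ and $\alpha^{\perp}=\alpha\rightarrow\Delta_A$.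 $\phi\in Con(A)\setminus\{\nabla_A\}$ is prime if $[\alpha,\beta]\subseteq\phi$ implies $\alpha\subseteq\phi$ or $\beta\subseteq\phi$ (for $\alpha,\beta\in Con(A)$); $Spec(A)$ is the set of prime congruences; $\rho(\theta)=\bigcap\{\phi\in Spec(A)\mid\theta\subseteq\phi\}$; $A$ is semiprime if $\rho(\Delta_A)=\Delta_A$. Reticulation: when $K(A)$ is closed under the commutator, $L(A)=K(A)/{\equiv}$ where $\alpha\equiv\beta$ iff $\rho(\alpha)=\rho(\beta)$; $\lambda_A:K(A)\to L(A)$ is the quotient map; $L(A)$ is a bounded distributive lattice with $\lambda_A(\alpha)\vee\lambda_A(\beta)=\lambda_A(\alpha\vee\beta)$, $\lambda_A(\alpha)\wedge\lambda_A(\beta)=\lambda_A([\alpha,\beta])$, $0=\lambda_A(\Delta_A)$, $1=\lambda_A(\nabla_A)$. For $\theta\in Con(A)$, $\theta^{\ast}=\{\lambda_A(\alpha)\mid\alpha\in K(A),\alpha\subseteq\theta\}$, an ideal of $L(A)$; for an ideal $I$ of $L(A)$, $I_{\ast}=\bigvee\{\alpha\in K(A)\mid\lambda_A(\alpha)\in I\}\in Con(A)$. For $\theta\in Con(A)$: $Ker(\theta)=\bigvee\{\alpha\in K(A)\mid\alpha\subseteq\theta,\ \theta\vee\alpha^{\perp}=\nabla_A\}$ and $\widetilde{Ker}(\theta)=\bigvee\{\alpha\in K(A)\mid\theta\vee(\alpha\rightarrow\rho(\Delta_A))=\nabla_A\}$. For an ideal $I$ of a bounded distributive lattice $L$: $\sigma(I)=\{x\in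 L\mid I\vee Ann(x)=L\}$ (join of ideals), where $Ann(x)=\{y\in L\mid x\wedge y=0\}$. *)

(* Defs.v *)
From HB Require Import structures.
From mathcomp Require Import all_boot all_order.
From mathcomp Require Import boolp classical_sets.

Set Implicit Arguments.
Unset Strict Implicit.
Unset Printing Implicit Defensive.

Import Order.TTheory.
Local Open Scope classical_set_scope.
Local Open Scope order_scope.

Local Obligation Tactic := idtac.

Record signature := Signature { symbol : finType; arity : symbol -> nat }.

Record algebra (S : signature) := Algebra {
  carrier :> Type;
  interp : forall f : symbol S, ('I_(arity f) -> carrier) -> carrier;
  carrier_inhabited : inhabited carrier }.

Inductive term (S : signature) : Type :=
| Var of nat
| App (f : symbol S) of ('I_(arity f) -> term S).

Fixpoint eval (S : signature) (A : algebra S) (e : nat -> A) (t : term S) : A :=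
  match t with
  | Var n => e n
  | App f ts => interp (fun i => eval e (ts i))
  end.

(* A variety is presented by a set of identities; its members are [valgebra V]. *)
Definition variety (S : signature) := set (term S * term S).

Definition models (S : signature) (V : variety S) (A : algebra S) : Prop :=
  forall t, V t -> forall e : nat -> A, eval e t.1 = eval e t.2.

Record valgebra (S : signature) (V : variety S) := VAlgebra {
  algebra_of :> algebra S;
  valgebraP : models V algebra_of }.

Record surj_morphism (S : signature) (A B : algebra S) := SurjMorphism {
  morph :> A -> B;
  morphP : forall (f : symbol S) (xs : 'I_(arity f) -> A),
    morph (interp xs) = interp (fun i => morph (xs i));
  morph_surj : forall y : B, exists x : A, morph x = y }.

Definition subalgebra (S : signature) (A : algebra S) (B : set A) : Prop :=
  B !=set0 /\ forall (f : symbol S) (xs : 'I_(arity f) -> A),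
    (forall i, B (xs i)) -> B (interp xs).

Definition semidegenerate (S : signature) (V : variety S) : Prop :=
  forall A : valgebra V, (exists x y : A, x <> y) ->
  ~ exists a : A, subalgebra [set a].

Record con (S : signature) (A : algebra S) := Con {
  crel :> A -> A -> Prop;
  crefl : forall x, crel x x;
  csym : forall x y, crel x y -> crel y x;
  ctrans : forall x y z, crel x y -> crel y z -> crel x z;
  ccompat : forall (f : symbol S) (xs ys : 'I_(arity f) -> A),
    (forall i, crel (xs i) (ys i)) -> crel (interp xs) (interp ys) }.

Section CongruenceLattice.
Context (S : signature) (A : algebra S).
Implicit Types (t u v : con A) (F : set (con A)).

Lemma con_ext t u : (forall x y, t x y <-> u x y) -> t = u.
Proof.
case: t u => [r a b c d] [r' a' b' c' d'] /= h.
have e : r = r' by apply/funext => x; apply/funext => y; apply/propext.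
by subst r'; congr Con; apply: Prop_irrelevance.
Qed.

HB.instance Definition _ := gen_eqMixin (con A).
HB.instance Definition _ := gen_choiceMixin (con A).

Program Definition con_inf F : con A :=
  @Con S A (fun x y => forall t, F t -> t x y) _ _ _ _.
Next Obligation. by move=> F x t _; apply: crefl. Qed.
Next Obligation. by move=> F x y h t Ft; apply/csym/h. Qed.
Next Obligation.
by move=> F x y z h k t Ft; apply: ctrans (h t Ft) (k t Ft).
Qed.
Next Obligation. by move=> F f xs ys h t Ft; apply: ccompat => i; apply: h. Qed.

Definition con_gen (R : A -> A -> Prop) : con A :=
  con_inf [set t | forall x y, R x y -> t x y].

Definition con_sup F : con A := con_gen (fun x y => exists2 t, F t & t x y).

Program Definition con_bot : con A := @Con S A (fun x y => x = y) _ _ _ _.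
Next Obligation. by []. Qed.
Next Obligation. by move=> x y ->. Qed.
Next Obligation. by move=> x y z -> ->. Qed.
Next Obligation. by move=> f xs ys h; congr interp; apply/funext. Qed.

Program Definition con_top : con A := @Con S A (fun _ _ => True) _ _ _ _.
Solve All Obligations with done.

Definition con_le t u : bool := `[< forall x y, t x y -> u x y >].

Definition con_meet t u : con A := con_inf [set t; u].

Definition con_join t u : con A := con_gen (fun x y => t x y \/ u x y).

Fact con_display : Order.disp_t. Proof. exact: Order.Disp tt tt. Qed.

Fact con_le_refl : reflexive con_le. Proof. by move=> t; apply/asboolP. Qed.

Fact con_le_anti : antisymmetric con_le.
Proof.
move=> t u /andP[/asboolP h /asboolP k].
by apply: con_ext => x y; split; [apply: h | apply: k].
Qed.

Fact con_le_trans : transitive con_le.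
Proof.
by move=> u t v /asboolP h /asboolP k; apply/asboolP => x y /h /k.
Qed.

HB.instance Definition _ := Order.Le_isPOrder.Build con_display (con A)
  con_le_refl con_le_anti con_le_trans.

Lemma con_leP t u : reflect (forall x y, t x y -> u x y) (t <= u).
Proof. exact: asboolP. Qed.

Lemma con_genP (R : A -> A -> Prop) t :
  con_gen R <= t <-> (forall x y, R x y -> t x y).
Proof.
split=> [/con_leP h x y Rxy|h]; first by apply: h => u; apply.
by apply/con_leP => x y; apply.
Qed.

Lemma con_infP F t : t <= con_inf F <-> (forall u, F u -> t <= u).
Proof.
split=> [/con_leP h u Fu|h]; apply/con_leP => x y txy; first exact: h.
by move=> u /h/con_leP; apply.
Qed.

Lemma con_supP F t : con_sup F <= t <-> (forall u, F u -> u <= t).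
Proof.
split=> [/con_genP h u Fu|h].
  by apply/con_leP => x y uxy; apply: h; exists u.
by apply/con_genP => x y [u /h/con_leP]; apply.
Qed.

Fact con_meetP u v t : (u <= con_meet v t) = (u <= v) && (u <= t).
Proof.
apply/idP/andP => [/con_infP h|[h k]]; first by split; apply: h; [left|right].
by apply/con_infP => w [] ->.
Qed.

Fact con_joinP u v t : (con_join u v <= t) = (u <= t) && (v <= t).
Proof.
apply/idP/andP => [/con_genP h|[/con_leP h /con_leP k]].
  by split; apply/con_leP => x y hxy; apply: h; [left|right].
by apply/con_genP => x y [/h|/k].
Qed.

HB.instance Definition _ := Order.POrder_MeetJoin_isLattice.Build
  con_display (con A) con_meetP con_joinP.

Fact con_bot_le t : con_bot <= t.
Proof. by apply/con_leP => x y ->; apply: crefl. Qed.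

Fact con_le_top t : t <= con_top. Proof. exact/con_leP. Qed.

HB.instance Definition _ := Order.hasBottom.Build con_display (con A) con_bot_le.
HB.instance Definition _ := Order.hasTop.Build con_display (con A) con_le_top.

Definition compact t : Prop :=
  forall F, t <= con_sup F ->
  exists2 s : seq (con A), (forall u, u \in s -> F u) & t <= \join_(u <- s) u.

End CongruenceLattice.

Definition modular_lattice d (L : latticeType d) : Prop :=
  forall x y z : L, x <= z -> (x `|` y) `&` z = x `|` (y `&` z).

Definition congruence_modular (S : signature) (V : variety S) : Prop :=
  forall A : valgebra V, modular_lattice (con A).

Section Transport.
Context (S : signature) (A B : algebra S) (f : surj_morphism A B).

Program Definition con_preim (t : con B) : con A :=
  @Con S A (fun x y => t (f x) (f y)) _ _ _ _.
Next Obligation. by move=> t x; apply: crefl. Qed.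
Next Obligation. by move=> t x y; apply: csym. Qed.
Next Obligation. by move=> t x y z; apply: ctrans. Qed.
Next Obligation. by move=> t g xs ys h /=; rewrite !morphP; apply: ccompat. Qed.

Definition con_ker : con A := con_preim \bot.

(* The direct image of t `|` Ker f (not of t itself), which is a congruence
   because f is onto. *)
Program Definition con_image (t : con A) : con B :=
  @Con S B (fun y y' => exists x x',
    [/\ f x = y, f x' = y' & (t `|` con_ker) x x']) _ _ _ _.
Next Obligation.
move=> t y; have [x <-] := morph_surj f y.
by exists x, x; split=> //; apply: crefl.
Qed.
Next Obligation.
by move=> t y y' [x [x' [<- <- h]]]; exists x', x; split=> //; apply: csym.
Qed.
Next Obligation.
move=> t y1 y2 y3 [x1 [x2 [<- <- h]]] [x2' [x3 [e <- k]]].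
exists x1, x3; split=> //; apply: ctrans h _; apply: ctrans k.
have /con_leP : con_ker <= t `|` con_ker by exact: leUr.
by apply; apply/esym.
Qed.
Next Obligation.
move=> t g ys ys' h.
have [xs hxs] := choice h; have [xs' hxs'] := choice hxs.
exists (interp xs), (interp xs'); rewrite !morphP; split.
- by congr interp; apply/funext => i; have [] := hxs' i.
- by congr interp; apply/funext => i; have [] := hxs' i.
- by apply: ccompat => i; have [] := hxs' i.
Qed.

End Transport.

Definition con_operation (S : signature) (V : variety S) :=
  forall A : valgebra V, con A -> con A -> con A.

Definition commutator_axioms (S : signature) (V : variety S)
    (C : con_operation V) : Prop :=
  forall (A B : valgebra V) (f : surj_morphism A B) (a b : con A),
    C A a b <= a `&` b /\
    C A a b `|` con_ker f = con_preim f (C B (con_image f a) (con_image f b)).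

Definition is_greatest_commutator (S : signature) (V : variety S)
    (C : con_operation V) : Prop :=
  commutator_axioms C /\
  forall D : con_operation V, commutator_axioms D ->
  forall (A : valgebra V) (a b : con A), D A a b <= C A a b.

(* The greatest operation satisfying the axioms, obtained by description. It
   exists when V is congruence-modular; the default value in the other case is
   irrelevant. *)
Definition commutator (S : signature) (V : variety S) : con_operation V :=
  match pselect (exists C : con_operation V, is_greatest_commutator C) with
  | left h => sval (cid h)
  | right _ => fun _ _ _ => \bot
  end.

Section Commutator.
Context (S : signature) (V : variety S) (A : valgebra V).
Implicit Types a b t p : con A.

Definition residual a b : con A := con_sup [set c | commutator a c <= b].

Definition annihilator a : con A := residual a \bot.

Definition prime_con p : Prop :=
  p <> \top /\ forall a b, commutator a b <= p -> a <= p \/ b <= p.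

Definition rho t : con A := con_inf [set p | prime_con p /\ t <= p].

Definition Ker t : con A :=
  con_sup [set a | [/\ compact a, a <= t & t `|` annihilator a = \top]].

(* The operator written Ker with a tilde. *)
Definition Kert t : con A :=
  con_sup [set a | compact a /\ t `|` residual a (rho \bot) = \top].

End Commutator.

Definition semiprime (S : signature) (V : variety S) (A : valgebra V) : Prop :=
  rho (\bot : con A) = \bot.

Definition commutator_closed (S : signature) (V : variety S) (A : valgebra V) :
    Prop :=
  forall a b : con A, compact a -> compact b -> compact (commutator a b).

Section Quotient.
Context (S : signature) (V : variety S) (A : valgebra V) (t : con A).

Definition quot_carrier := {X : A -> Prop | exists a, X = t a}.

Definition quot_class (a : A) : quot_carrier :=
  exist _ (t a : A -> Prop) (ex_intro _ a erefl).

Definition quot_rep (X : quot_carrier) : A := sval (cid (svalP X)).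

Lemma quot_ext (X Y : quot_carrier) : sval X = sval Y -> X = Y.
Proof.
case: X Y => [X p] [Y q] /= e; subst Y.
by congr exist; apply: Prop_irrelevance.
Qed.

Lemma quot_classP a b : t a b <-> quot_class a = quot_class b.
Proof.
split=> [h|[->]]; last exact: crefl.
apply: quot_ext => /=; apply/funext => x; apply/propext.
by split=> k; [apply: ctrans k; apply: csym | apply: ctrans k].
Qed.

Lemma quot_repK X : quot_class (quot_rep X) = X.
Proof.
by apply: quot_ext => /=; rewrite /quot_rep; case: cid => a /= ->.
Qed.

Definition quot_alg : algebra S := {|
  carrier := quot_carrier;
  interp := fun f Xs => quot_class (interp (fun i => quot_rep (Xs i)));
  carrier_inhabited :=
    let: inhabits a := carrier_inhabited A in inhabits (quot_class a) |}.

Lemma quot_morph (f : symbol S) (xs : 'I_(arity f) -> A) :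
  quot_class (interp xs) =
  @interp S quot_alg f (fun i => quot_class (xs i)).
Proof.
by apply/quot_classP; apply: ccompat => i; apply/quot_classP; rewrite quot_repK.
Qed.

Lemma quot_eval (e : nat -> quot_alg) (u : term S) :
  eval e u = quot_class (eval (fun n => quot_rep (e n)) u).
Proof.
elim: u => [n|f us ih] /=; first by rewrite quot_repK.
by apply/quot_classP; apply: ccompat => i; apply/quot_classP; rewrite quot_repK.
Qed.

Lemma quot_models : models V quot_alg.
Proof. by move=> u Vu e; rewrite !quot_eval (valgebraP Vu). Qed.

Definition quot_valg : valgebra V := VAlgebra quot_models.

End Quotient.

Section Auxiliary.
Context (S : signature) (V : variety S).

Program Definition id_morphism (A : algebra S) : surj_morphism A A :=
  @SurjMorphism S A A id _ _.
Next Obligation. by []. Qed.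
Next Obligation. by move=> A y; exists y. Qed.

Lemma commutator_le (A : valgebra V) (a b : con A) : commutator a b <= a `&` b.
Proof.
rewrite /commutator; case: pselect => [h|_]; last exact: le0x.
by case: cid => C [h' _] /=; case: (h' A A (id_morphism A) a b).
Qed.

Lemma con_sup_finite (A : algebra S) (F : set (con A)) x y :
  con_sup F x y -> exists2 s : seq (con A),
    (forall u, u \in s -> F u) & (\join_(u <- s) u) x y.
Proof.
pose r x y := exists2 s : seq (con A),
  (forall u, u \in s -> F u) & (\join_(u <- s) u) x y.
have weaken (s s' : seq (con A)) : {subset s <= s'} ->
    \join_(u <- s) u <= \join_(u <- s') u.
  by move=> h; apply/joinsP_seq => u us _; apply: joins_min_seq (h u us) _ (lexx u).
have rr z : r z z by exists [::] => //; apply: crefl.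
have rs z w : r z w -> r w z by move=> [s h k]; exists s => //; apply: csym.
have rt z w v : r z w -> r w v -> r z v.
  move=> [s h k] [s' h' k']; exists (s ++ s').
    by move=> u; rewrite mem_cat => /orP[/h|/h'].
  apply: (ctrans (y := w)).
    by apply: (con_leP _ _ (weaken s _ _)) k => u us; rewrite mem_cat us.
  by apply: (con_leP _ _ (weaken s' _ _)) k' => u us; rewrite mem_cat us orbT.
have rc (f : symbol S) (xs ys : 'I_(arity f) -> A) :
    (forall i, r (xs i) (ys i)) -> r (interp xs) (interp ys).
  move=> h.
  have /choice [s hs] : forall i, exists s : seq (con A),
      (forall u, u \in s -> F u) /\ (\join_(u <- s) u) (xs i) (ys i).
    by move=> i; have [s ? ?] := h i; exists s.
  exists (flatten [seq s i | i <- enum 'I_(arity f)]).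
    by move=> u /flatten_mapP[i _ us]; have [k _] := hs i; apply: k.
  apply: ccompat => i; have [_ k] := hs i.
  apply: (con_leP _ _ (weaken (s i) _ _)) k => u us.
  by apply/flatten_mapP; exists i; rewrite // mem_enum.
pose R := Con rr rs rt rc.
suff /con_leP h : con_sup F <= R by move/h.
apply/con_supP => u Fu; apply/con_leP => z w uzw; exists [:: u].
  by move=> v; rewrite inE => /eqP ->.
by rewrite big_seq1.
Qed.

Lemma compact_top (Vsd : semidegenerate V) (A : valgebra V) :
  compact (\top : con A).
Proof.
move=> F /con_leP h.
have [a] := carrier_inhabited A.
have /choice [s hs] : forall f : symbol S, exists s : seq (con A),
    (forall u, u \in s -> F u) /\
    (\join_(u <- s) u) a (interp (fun _ : 'I_(arity f) => a)).
  move=> f; have [s ? ?] :=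
    con_sup_finite (h a (interp (fun _ : 'I_(arity f) => a)) I).
  by exists s.
exists (flatten [seq s f | f <- enum (symbol S)]).
  by move=> u /flatten_mapP[f _ us]; have [k _] := hs f; apply: k.
set j := \join_(u <- _) u.
have ja (f : symbol S) : j a (interp (fun _ : 'I_(arity f) => a)).
  have [_ k] := hs f; suff /con_leP : \join_(u <- s f) u <= j by apply.
  apply/joinsP_seq => u us _; apply: joins_min_seq _ _ (lexx u) => //=.
  by apply/flatten_mapP; exists f; rewrite // mem_enum.
apply/con_leP => x y _; apply: contrapT => nxy.
apply: (Vsd (quot_valg j)).
  by exists (quot_class j x), (quot_class j y) => /quot_classP.
exists (quot_class j a); split; first by exists (quot_class j a).
move=> f Xs hX /=; apply/esym/quot_classP; apply: ctrans (ja f) _.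
by apply: ccompat => i; apply/quot_classP; rewrite quot_repK hX.
Qed.

Lemma compact_bot (A : algebra S) : compact (\bot : con A).
Proof. by move=> F _; exists [::] => // ; rewrite le0x. Qed.

Lemma compact_join (A : algebra S) (a b : con A) :
  compact a -> compact b -> compact (a `|` b).
Proof.
move=> ca cb F; rewrite leUx => /andP[/ca[s hs ls] /cb[s' hs' ls']].
exists (s ++ s'); first by move=> u; rewrite mem_cat => /orP[/hs|/hs'].
by rewrite big_cat leU2.
Qed.

End Auxiliary.

Record compact_con (S : signature) (A : algebra S) := CompactCon {
  compact_con_val :> con A;
  _ : `[< compact compact_con_val >] }.

HB.instance Definition _ (S : signature) (A : algebra S) :=
  [isSub for @compact_con_val S A].
HB.instance Definition _ (S : signature) (A : algebra S) :=
  [Choice of compact_con A by <:].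

Lemma compact_conP (S : signature) (A : algebra S) (a : compact_con A) :
  compact a.
Proof. by case: a => a /= /asboolP. Qed.

Arguments compact_conP {S A} a.

Definition mk_compact (S : signature) (A : algebra S) (a : con A)
  (ca : compact a) : compact_con A := CompactCon (asboolT ca).

Section RhoEquiv.
Context (S : signature) (V : variety S) (A : valgebra V).

Definition rho_rel : rel (compact_con A) := fun a b => rho a == rho b.

Fact rho_rel_equiv : equiv_class_of rho_rel.
Proof.
split=> [a|a b|b a c]; first exact: eqxx; first exact: eq_sym.
by rewrite /rho_rel => /eqP ->.
Qed.

Canonical rho_equiv := EquivRelPack rho_rel_equiv.

End RhoEquiv.

(* L(A) depends on the two hypotheses making it a bounded lattice: the top
   congruence is compact, and compact congruences are closed under the commutator. *)
Definition reticulation (S : signature) (V : variety S)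
    (Vsd : semidegenerate V) (A : valgebra V) (Acl : commutator_closed A) :=
  {eq_quot (rho_equiv A)}%qT.

Section Reticulation.
Context (S : signature) (V : variety S) (Vsd : semidegenerate V).
Context (A : valgebra V) (Acl : commutator_closed A).

Local Notation L := (reticulation Vsd Acl).

HB.instance Definition _ := Choice.on L.

Definition lambda (a : compact_con A) : L := (\pi_({eq_quot (rho_equiv A)}) a)%qT.

Definition lrepr (x : L) : compact_con A :=
  repr (x : {eq_quot (rho_equiv A)}%qT).

Lemma lreprK x : lambda (lrepr x) = x.
Proof. exact: reprK. Qed.

Lemma lambdaP a b : lambda a = lambda b <-> rho a = rho b.
Proof.
split=> [/eqmodP/eqP //|h].
by apply/eqmodP; rewrite /= /rho_rel h.
Qed.

Definition ret_le (x y : L) : bool := rho (lrepr x) <= rho (lrepr y).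

Definition ret_meet (x y : L) : L :=
  lambda (mk_compact
    (Acl (compact_conP (lrepr x)) (compact_conP (lrepr y)))).

Definition ret_join (x y : L) : L :=
  lambda (mk_compact
    (compact_join (compact_conP (lrepr x)) (compact_conP (lrepr y)))).

Definition ret_bot : L := lambda (mk_compact (@compact_bot S A)).

Definition ret_top : L := lambda (mk_compact (compact_top Vsd (A := A))).

Lemma rho_leP (a b : con A) :
  rho a <= rho b <-> (forall p, prime_con p -> b <= p -> a <= p).
Proof.
split=> [h p pp bp|h].
  have rap : rho a <= p.
    by apply: le_trans h _; have /con_infP := lexx (rho b); apply.
  by apply: le_trans rap; apply/con_infP => q [].
apply/con_infP => q [pq bq].
by have /con_infP := lexx (rho a); apply; split=> //; apply: h.
Qed.

Lemma rho_lrepr a : rho (lrepr (lambda a)) = rho a.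
Proof. by apply/lambdaP; rewrite lreprK. Qed.

Lemma prime_lrepr a (p : con A) : prime_con p ->
  (lrepr (lambda a) : con A) <= p <-> (a : con A) <= p.
Proof.
move=> pp; have /eqP := rho_lrepr a.
by rewrite eq_le => /andP[/rho_leP h /rho_leP k]; split; [apply: k|apply: h].
Qed.

Lemma prime_comm (a b p : con A) : prime_con p ->
  commutator a b <= p <-> (a <= p \/ b <= p).
Proof.
move=> [_ pp]; split; first exact: pp.
by case=> h; apply: le_trans (commutator_le a b) _; apply: le_trans h;
  [exact: leIl | exact: leIr].
Qed.

Lemma ret_leP x y : ret_le x y <-> (forall p, prime_con p ->
  (lrepr y : con A) <= p -> (lrepr x : con A) <= p).
Proof. exact: rho_leP. Qed.

Lemma prime_meet x y (p : con A) : prime_con p ->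
  (lrepr (ret_meet x y) : con A) <= p <->
  ((lrepr x : con A) <= p \/ (lrepr y : con A) <= p).
Proof.
by move=> pp; apply: (iff_trans (prime_lrepr _ pp)); apply: prime_comm.
Qed.

Lemma prime_join x y (p : con A) : prime_con p ->
  (lrepr (ret_join x y) : con A) <= p <->
  ((lrepr x : con A) <= p /\ (lrepr y : con A) <= p).
Proof.
move=> pp; apply: (iff_trans (prime_lrepr _ pp)); rewrite /= leUx.
exact: iff_sym (rwP andP).
Qed.

Fact ret_display : Order.disp_t. Proof. exact: Order.Disp tt tt. Qed.

Fact ret_le_refl : reflexive ret_le. Proof. by move=> x; exact: lexx. Qed.

Fact ret_le_anti : antisymmetric ret_le.
Proof.
move=> x y /le_anti h; rewrite -(lreprK x) -(lreprK y).
exact/lambdaP.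
Qed.

Fact ret_le_trans : transitive ret_le.
Proof. by move=> y x z; exact: le_trans. Qed.

HB.instance Definition _ := Order.Le_isPOrder.Build ret_display L
  ret_le_refl ret_le_anti ret_le_trans.

Fact ret_meetP x y z : (x <= ret_meet y z) = (x <= y) && (x <= z).
Proof.
apply/idP/andP => [/ret_leP h|[/ret_leP h /ret_leP k]].
  by split; apply/ret_leP => p pp l; apply: h => //; apply/prime_meet;
    auto.
by apply/ret_leP => p pp /prime_meet[//||]; [apply: h|apply: k].
Qed.

Fact ret_joinP x y z : (ret_join x y <= z) = (x <= z) && (y <= z).
Proof.
apply/idP/andP => [/ret_leP h|[/ret_leP h /ret_leP k]].
  by split; apply/ret_leP => p pp l;
    have /prime_join[] := h p pp l.
by apply/ret_leP => p pp l; apply/prime_join => //; split; [apply: h|apply: k].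
Qed.

HB.instance Definition _ := Order.POrder_MeetJoin_isLattice.Build
  ret_display L ret_meetP ret_joinP.

Fact ret_meetUl : @left_distributive L L Order.meet Order.join.
Proof.
move=> x y z; apply: le_anti; apply/andP; split; apply/ret_leP => p pp.
  move=> /prime_join[//|/(prime_meet _ _ pp) h /(prime_meet _ _ pp) k].
  apply/(prime_meet _ _ pp).
  case: h k => [h|]; last by right.
  by case=> [k|]; [left; apply/prime_join | right].
move=> /(prime_meet _ _ pp) h; apply/(prime_join _ _ pp).
case: h => [/(prime_join _ _ pp)[h k]|h]; split; apply/(prime_meet _ _ pp); auto.
Qed.

HB.instance Definition _ :=
  Order.Lattice_Meet_isDistrLattice.Build ret_display L ret_meetUl.

Fact ret_bot_le x : ret_bot <= x.
Proof.
by apply/ret_leP => p pp _; apply/(prime_lrepr _ pp); exact: le0x.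
Qed.

Fact ret_le_top x : x <= ret_top.
Proof.
apply/ret_leP => p pp /(prime_lrepr _ pp) /=.
by rewrite le1x => /eqP ->; exact: lex1.
Qed.

HB.instance Definition _ := Order.hasBottom.Build ret_display L ret_bot_le.
HB.instance Definition _ := Order.hasTop.Build ret_display L ret_le_top.

Lemma lambda_comm (a b : compact_con A) :
  lambda a `&` lambda b =
  lambda (mk_compact (Acl (compact_conP a) (compact_conP b))).
Proof.
apply/lambdaP/le_anti/andP; split; apply/rho_leP => p pp /= /(prime_comm _ _ pp);
  move=> h; apply/(prime_comm _ _ pp);
  by case: h => /(prime_lrepr _ pp) h; [left|right].
Qed.

Lemma lambda_join (a b : compact_con A) :
  lambda a `|` lambda b =
  lambda (mk_compact (compact_join (compact_conP a) (compact_conP b))).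
Proof.
apply/lambdaP/le_anti/andP; split; apply/rho_leP => p pp /=;
  rewrite !leUx => /andP[h k]; apply/andP; split;
  by apply/(prime_lrepr _ pp).
Qed.

(* theta^* and I_* for theta in Con(A) and I an ideal of L(A). *)
Definition upper_star (t : con A) : set L :=
  [set lambda a | a in [set a : compact_con A | (a : con A) <= t]].

Definition lower_star (I : set L) : con A :=
  con_sup [set (a : con A) | a in [set a : compact_con A | I (lambda a)]].

End Reticulation.

Arguments lambda {S V} Vsd {A} Acl a.
Arguments upper_star {S V} Vsd {A} Acl t.

Section Ideals.
Context (d : Order.disp_t) (L : tbDistrLatticeType d).
Implicit Types I J : set L.

Definition lattice_ideal I : Prop :=
  [/\ I \bot, forall x y, x <= y -> I y -> I x
    & forall x y, I x -> I y -> I (x `|` y)].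

(* Join in the lattice of ideals: the least ideal containing I and J. *)
Definition ideal_join I J : set L :=
  [set x | forall K, lattice_ideal K -> I `<=` K -> J `<=` K -> K x].

Definition Ann (x : L) : set L := [set y | x `&` y = \bot].

Definition sigma I : set L := [set x | ideal_join I (Ann x) = setT].

End Ideals.

(* Main.v *)
Require Import Defs.
From mathcomp Require Import all_boot all_order.
From mathcomp Require Import boolp classical_sets.

(** The proof has two independent halves.

    The lattice half. Membership of lambda(a) in sigma(theta^* ) says that
    1 = lambda(b) \/ lambda(c) for some compact b below theta and some compact c
    with lambda(a) /\ lambda(c) = 0. The second condition means that
    [a, c] <= rho(bottom), so that c lies below the residual of a by rho(bottom).
    If moreover lambda(e) = 1 forces e to be the top congruence, the first
    condition means that b and c join to top. Hence ([sigma_upper_star])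
      lambda(a) in sigma(theta^* )  iff  theta \/ (a -> rho(bottom)) = top,
    and the right-hand side is the condition on the generators of the tilde
    kernel. The two identities for the tilde kernel follow because sigma of an
    ideal is an ideal and because every compact congruence below a supremum lies
    below a finite join. When rho(bottom) = bottom, the residual a -> rho(bottom)
    is the annihilator of a, and only the requirement a <= theta in the
    definition of Ker is left: either a is replaced by [a, b], which has the same
    class, or theta comes from an ideal I and sigma(I) is contained in I.
    Inclusions of commutators in rho(bottom) are tested on prime congruences p,
    for which [a, c] <= p means a <= p or c <= p.

    The universal algebra half. It remains to see that lambda(e) = 1 forces
    e = top: every proper congruence must lie below a prime one. As top is
    compact, every proper congruence lies below a maximal one m, and m is prime
    as soon as [top, top] = top holds in the quotient by m: if a and b are not
    below m, their images in the quotient are top, so [a, b] \/ m = top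
    ([commutator_comaximal], [maximal_prime]).

    To prove [top, top] = top, use that the commutator is the greatest operation
    satisfying two axioms: it is enough to exhibit one such operation with this
    property. It is the Hagemann-Herrmann commutator, defined through the
    congruence Delta_{a,b} of the subalgebra a of A * A that is generated by the
    pairs of diagonal elements related by b. Congruence modularity, in the form
    of the shifting lemma, shows that this operation is symmetric and compatible
    with joins, hence satisfies the axioms ([hh_axioms]). For a = b = top, the
    diagonal is one element of the quotient of A * A by Delta, and that element
    is a subalgebra; semidegeneracy makes the quotient trivial, so the
    Hagemann-Herrmann commutator of top with itself is top ([hh_top]). *)

Set Implicit Arguments.
Unset Strict Implicit.
Unset Printing Implicit Defensive.

Import Order.TTheory.
Local Open Scope classical_set_scope.
Local Open Scope order_scope.
Local Obligation Tactic := idtac.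

(** * Congruences along homomorphisms and transitive closures *)

Section Pull.
Context (S : signature).

Definition homomorphism (A B : algebra S) (g : A -> B) : Prop :=
  forall (f : symbol S) (xs : 'I_(arity f) -> A),
    g (interp xs) = interp (fun i => g (xs i)).

(** Unlike [con_preim], this does not ask for surjectivity: it is also needed
    for the diagonal embedding of an algebra into a congruence. *)
Program Definition con_pull (A B : algebra S) (g : A -> B)
    (gh : homomorphism g) (t : con B) : con A :=
  @Con S A (fun x y => t (g x) (g y)) _ _ _ _.
Next Obligation. by move=> A B g gh t x; apply: crefl. Qed.
Next Obligation. by move=> A B g gh t x y; apply: csym. Qed.
Next Obligation. by move=> A B g gh t x y z; apply: ctrans. Qed.
Next Obligation.
by move=> A B g gh t f xs ys h /=; rewrite !gh; apply: ccompat.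
Qed.

Lemma eval_homomorphism (A B : algebra S) (g : A -> B) (gh : homomorphism g)
  (e : nat -> A) u : g (eval e u) = eval (fun n => g (e n)) u.
Proof.
by elim: u => [//|f us ih] /=; rewrite gh; congr interp; apply/funext.
Qed.

Lemma con_meetE (A : algebra S) (t u : con A) x y :
  (t `&` u) x y <-> t x y /\ u x y.
Proof.
split=> [h|[h k]]; last by move=> _ [->|->].
by split; [apply: (con_leP _ _ (leIl t u)) | apply: (con_leP _ _ (leIr u t))].
Qed.

Lemma con_gen_in (A : algebra S) (R : A -> A -> Prop) x y :
  R x y -> con_gen R x y.
Proof. by have /con_genP := lexx (con_gen R); apply. Qed.

Section Iterate.
Context (A : algebra S) (R : A -> A -> Prop).
Hypotheses (Rrefl : forall x, R x x) (Rsym : forall x y, R x y -> R y x).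
Hypothesis Rcompat : forall (f : symbol S) (xs ys : 'I_(arity f) -> A),
  (forall i, R (xs i) (ys i)) -> R (interp xs) (interp ys).

(** Chains are counted by their length, so that chains for the finitely many
    arguments of an operation can be padded to a common length; this is why the
    transitive closure is again compatible. *)
Fixpoint steps n x y : Prop :=
  if n is m.+1 then exists2 z, R x z & steps m z y else x = y.

Lemma steps_cat m n x y z : steps m x y -> steps n y z -> steps (m + n) x z.
Proof.
elim: m x => [|m ih] x /= => [->//|[w xw wy] yz].
by exists w => //; apply: ih.
Qed.

Lemma steps_pad m n x y : (m <= n)%N -> steps m x y -> steps n x y.
Proof.
move=> mn h; rewrite -(subnK mn); apply: steps_cat h.
by elim: (n - m)%N => //= k ih; exists x.
Qed.

Program Definition transitive_con : con A :=
  @Con S A (fun x y => exists n, steps n x y) _ _ _ _.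
Next Obligation. by move=> x; exists 0. Qed.
Next Obligation.
move=> x y [n h]; exists n; elim: n x y h => [|n ih] x y /= => [->//|[z xz zy]].
suff : steps (n + 1) y x by rewrite addn1.
by apply: steps_cat (ih _ _ zy) _; exists x => //; apply: Rsym.
Qed.
Next Obligation.
by move=> x y z [m h] [n k]; exists (m + n)%N; apply: steps_cat h k.
Qed.
Next Obligation.
move=> f xs ys /choice [n hn].
exists (\max_(i < arity f) n i)%N.
have {hn} : forall i, steps (\max_(i < arity f) n i)%N (xs i) (ys i).
  by move=> i; apply: steps_pad (hn i); exact: (leq_bigmax i).
elim: (\max_(i < arity f) n i)%N xs => [|m ih] xs /= h.
  by congr interp; apply/funext.
have /choice [zs hz] : forall i, exists z, R (xs i) z /\ steps m z (ys i).
  by move=> i; have [z ? ?] := h i; exists z.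
exists (interp zs); first by apply: Rcompat => i; have [] := hz i.
by apply: ih => i; have [] := hz i.
Qed.

End Iterate.
End Pull.

(** * A congruence as a subalgebra of the square, and the congruence Delta *)

Section Graph.
Context (S : signature) (V : variety S) (A : valgebra V) (a : con A).

(** Pairs in [a] are pictured as columns, with [lo] and [hi] their entries. *)
Definition graph_carrier := {p : A * A | a p.1 p.2}.

Definition lo (p : graph_carrier) : A := (sval p).1.
Definition hi (p : graph_carrier) : A := (sval p).2.
Definition mkgraph x y (h : a x y) : graph_carrier :=
  exist (fun p : A * A => a p.1 p.2) (x, y) h.

Lemma graph_ext (p q : graph_carrier) : lo p = lo q -> hi p = hi q -> p = q.
Proof.
case: p q => [[x y] h] [[u v] k]; rewrite /lo /hi /= => e1 e2.
by subst u v; congr exist; apply: Prop_irrelevance.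
Qed.

Definition graph_alg : algebra S := {|
  carrier := graph_carrier;
  interp := fun f ps => mkgraph
    (ccompat (xs := lo \o ps) (ys := hi \o ps) (fun i => svalP (ps i)));
  carrier_inhabited :=
    let: inhabits x := carrier_inhabited A in inhabits (mkgraph (crefl a x)) |}.

Lemma lo_hom : homomorphism (lo : graph_alg -> A). Proof. by []. Qed.
Lemma hi_hom : homomorphism (hi : graph_alg -> A). Proof. by []. Qed.

Lemma graph_models : models V graph_alg.
Proof.
move=> u Vu e; apply: graph_ext.
  by rewrite !(eval_homomorphism lo_hom) (valgebraP Vu).
by rewrite !(eval_homomorphism hi_hom) (valgebraP Vu).
Qed.

Definition graph : valgebra V := VAlgebra graph_models.

Definition diag (x : A) : graph := mkgraph (crefl a x).

Lemma diag_hom : homomorphism diag.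
Proof. by move=> f xs; apply: graph_ext. Qed.

Definition con_lo (t : con A) : con graph := con_pull lo_hom t.
Definition con_hi (t : con A) : con graph := con_pull hi_hom t.

Definition Delta (b : con A) : con graph :=
  con_gen (fun p q : graph => [/\ lo p = hi p, lo q = hi q & b (lo p) (lo q)]).

Lemma DeltaP (b : con A) (t : con graph) :
  Delta b <= t <-> b <= con_pull diag_hom t.
Proof.
split=> [/con_genP h|/con_leP h].
  by apply/con_leP => x y bxy; apply: h.
apply/con_genP => p q [ep eq bpq].
have -> : p = diag (lo p) by apply: graph_ext.
have -> : q = diag (lo q) by apply: graph_ext.
exact: h.
Qed.

Lemma Delta_diag (b : con A) x y : b x y -> Delta b (diag x) (diag y).
Proof. by have /DeltaP/con_leP := lexx (Delta b); apply. Qed.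

Lemma Delta_lo (b : con A) (p q : graph) : Delta b p q -> b (lo p) (lo q).
Proof.
suff /con_leP : Delta b <= con_lo b by apply.
by apply/DeltaP/con_leP.
Qed.

(** The Hagemann-Herrmann commutator of [a] and [b]. *)
Definition hh_commutator (b : con A) : con A :=
  con_gen (fun y y' => exists p q : graph,
    [/\ Delta b p q, lo p = lo q, hi p = y & hi q = y']).

Lemma hhP (b d : con A) :
  hh_commutator b <= d <-> Delta b `&` con_lo \bot <= con_hi d.
Proof.
split=> [/con_genP h|/con_leP h].
  by apply/con_leP => p q /con_meetE [Dpq epq]; apply: h; exists p, q.
by apply/con_genP => _ _ [p [q [Dpq epq <- <-]]]; apply: h; apply/con_meetE.
Qed.

Lemma hh_le (b : con A) : hh_commutator b <= a `&` b.
Proof.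
apply/con_genP => _ _ [p [q [Dpq epq <- <-]]]; apply/con_meetE; split.
  apply: (ctrans (csym (svalP p))); rewrite -/(lo p) epq; exact: (svalP q).
suff /con_leP : Delta b <= con_hi b by apply.
by apply/DeltaP/con_leP.
Qed.

End Graph.

(** * The Hagemann-Herrmann commutator in a congruence-modular variety *)

Section Modular.
Context (S : signature) (V : variety S) (Vmod : congruence_modular V).

(** Gumm's shifting lemma. The points x, t and y, z span a rectangle with
    sides in [u] and [v]; the relation [w] moves from the side y z to the
    opposite side x t because the modular law gives
    u /\ ((u /\ w) \/ v) = (u /\ w) \/ (u /\ v) <= w. *)
Lemma shifting (B : valgebra V) (u v w : con B) x y z t :
  u `&` v <= w -> v x y -> u y z -> w y z -> v z t -> u x t -> w x t.
Proof.
move=> uvw vxy uyz wyz vzt uxt.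
have m := Vmod v (leIl u w).
suff : ((u `&` w) `|` (v `&` u)) x t.
  by apply: (con_leP _ _ _); rewrite leUx leIr meetC uvw.
rewrite -m; apply/con_meetE; split=> //.
have /con_leP vj := leUr v (u `&` w).
apply: ctrans (vj _ _ vxy) _; apply: ctrans (vj _ _ vzt).
by apply: (con_leP _ _ (leUl (u `&` w) v)); apply/con_meetE.
Qed.

Section OneAlgebra.
Context (A : valgebra V).
Implicit Types a b d k : con A.

(** Shift in the algebra [a], in the rectangle formed by [p], [q] and the
    diagonal columns with the same lower entries: [con_hi a d] holds on the
    diagonal side, where upper and lower entries agree. *)
Lemma hh_row a b d (p q : graph a) : hh_commutator a b <= d ->
  Delta a b p q -> d (lo p) (lo q) -> d (hi p) (hi q).
Proof.
move=> /hhP h Dpq dpq.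
apply: (@shifting _ (Delta a b) (con_lo a \bot) (con_hi a d) p
  (diag a (lo p)) (diag a (lo q)) q) => //.
by apply: Delta_diag; apply: Delta_lo.
Qed.

(** The right-hand side is the term condition for columns. It is not visibly
    preserved when [d] grows, whereas the left-hand side is; this is where
    modularity gives more than the term condition has in general. *)
Lemma hh_col a b d : hh_commutator a b <= d <->
  forall p q, Delta a b p q -> d (lo p) (hi p) -> d (lo q) (hi q).
Proof.
split=> [/hhP h p q Dpq dp|h].
  apply: (@shifting _ (con_lo a \bot) (Delta a b) (con_hi a d)
    (diag a (lo q)) (diag a (lo p)) p q) => //; first by rewrite meetC.
  by apply: csym; apply: Delta_diag; apply: Delta_lo.
apply/con_genP => _ _ [p [q [Dpq epq <- <-]]].
have a' : a (hi p) (hi q).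
  apply: (ctrans (csym (svalP p))); rewrite -/(lo p) epq; exact: (svalP q).
apply: (h (diag a (hi p)) (mkgraph a')); last exact: crefl.
apply: (@shifting _ (con_lo a \bot) (con_hi a \bot) (Delta a b) _ p q) => //.
apply/con_leP => x y /con_meetE [e1 e2].
by rewrite (graph_ext e1 e2); apply: crefl.
Qed.

(** The rows of a matrix whose columns are related by [Delta a b] are columns of
    the transposed matrix. Transposition does not preserve transitivity, so
    [Delta b a] is only contained in the transitive closure of the transposed
    relation, and the row condition of [hh_row] is carried along its chains. *)
Lemma hh_sym a b d : hh_commutator a b <= d -> hh_commutator b a <= d.
Proof.
move=> h; apply/hh_col.
(* The witnesses p' and q' are the columns whose rows are p and q; R is R0 made
   symmetric. *)
pose R0 (p q : graph b) := exists p' q' : graph a, Delta a b p' q' /\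
  [/\ lo p' = lo p, lo q' = hi p, hi p' = lo q & hi q' = hi q].
pose R p q := R0 p q /\ R0 q p.
have R0refl p : R0 p p.
  exists (diag a (lo p)), (diag a (hi p)); split=> //.
  by apply: Delta_diag; exact: (svalP p).
have R0compat (f : symbol S) (ps qs : 'I_(arity f) -> graph b) :
    (forall i, R0 (ps i) (qs i)) -> R0 (interp ps) (interp qs).
  move=> /choice [ps' /choice [qs' k]]; exists (interp ps'), (interp qs').
  split; first by apply: ccompat => i; have [] := k i.
  split; [rewrite !lo_hom|rewrite lo_hom hi_hom|rewrite hi_hom lo_hom|
    rewrite !hi_hom]; congr interp; apply/funext => i;
    by have [_ []] := k i.
have Rrefl p : R p p by [].
have Rsym p q : R p q -> R q p by case.
have Rcompat (f : symbol S) (ps qs : 'I_(arity f) -> graph b) :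
    (forall i, R (ps i) (qs i)) -> R (interp ps) (interp qs).
  by move=> k; split; apply: R0compat => i; have [] := k i.
have gens x y : a x y -> R0 (diag b x) (diag b y).
  by move=> axy; exists (mkgraph axy), (mkgraph axy); split=> //; apply: crefl.
have /con_leP DT : Delta b a <= transitive_con Rrefl Rsym Rcompat.
  apply/DeltaP/con_leP => x y axy; exists 1%N, (diag b y) => //.
  by split; apply: gens => //; apply: csym.
move=> p q /DT [n]; elim: n p => [p -> //|n ih] p /= [r [+ _] /ih rq] dp.
move=> [p' [q' [Dpq [e1 e2 e3 e4]]]]; apply: rq.
by rewrite -e3 -e4; apply: hh_row h Dpq _; rewrite e1 e2.
Qed.

(** The modular law reduces the join to [Delta a b] alone: since
    d * d <= [con_lo a d], one has
    (Delta \/ d * d) /\ con_lo d = (Delta /\ con_lo d) \/ d * d. *)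
Lemma hh_row_join a b d (p q : graph a) : hh_commutator a b <= d ->
  (Delta a b `|` (con_lo a d `&` con_hi a d)) p q ->
  d (lo p) (lo q) -> d (hi p) (hi q).
Proof.
move=> h jpq dpq.
have m := Vmod (Delta a b) (leIl (con_lo a d) (con_hi a d)).
have : ((con_lo a d `&` con_hi a d) `|` (Delta a b `&` con_lo a d)) p q.
  by rewrite -m; apply/con_meetE; rewrite joinC.
suff /con_leP : (con_lo a d `&` con_hi a d) `|` (Delta a b `&` con_lo a d)
    <= con_hi a d by apply.
rewrite leUx leIr; apply/con_leP => x y /con_meetE [Dxy dxy].
exact: hh_row h Dxy dxy.
Qed.

Lemma hh_joinr a b d k : hh_commutator a b <= d -> k <= d ->
  hh_commutator a (b `|` k) <= d.
Proof.
move=> h kd; apply/hhP/con_leP => p q /con_meetE [Dpq epq].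
apply: (hh_row_join h); last first.
  by have -> : lo p = lo q; [exact: epq|apply: crefl].
suff /con_leP : Delta a (b `|` k) <=
  Delta a b `|` (con_lo a d `&` con_hi a d) by apply.
apply/DeltaP; rewrite leUx; apply/andP; split.
  by apply/DeltaP; exact: leUl.
apply/con_leP => x y kxy; apply: (con_leP _ _ (leUr _ _)); apply/con_meetE.
by split; apply: (con_leP _ _ kd).
Qed.

(** The diagonal is one class of [Delta \top \top], and as an element of the
    quotient it forms a subalgebra; by semidegeneracy the quotient of the square
    is trivial. *)
Lemma hh_top (Vsd : semidegenerate V) :
  hh_commutator (\top : con A) \top = \top.
Proof.
apply: le_anti; rewrite lex1 /=; apply/con_leP => x y _.
pose G := graph (\top : con A).
have full (p q : G) : Delta \top \top p q.
  apply: contrapT => npq; apply: (Vsd (quot_valg (Delta (\top : con A) \top))).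
    by exists (quot_class (Delta \top \top) p), (quot_class (Delta \top \top) q)
      => /quot_classP.
  exists (quot_class (Delta \top \top) (diag \top x)).
  split; first by eexists; reflexivity.
  move=> f Xs hX /=; apply/esym/quot_classP.
  have /quot_classP := Delta_diag (a := \top)
    (I : (\top : con A) x (interp (fun _ : 'I_(arity f) => x))).
  rewrite diag_hom => /quot_classP k; apply: ctrans k _.
  by apply: ccompat => i; apply/quot_classP; rewrite quot_repK hX.
apply: con_gen_in.
by exists (mkgraph (I : (\top : con A) x x)),
  (mkgraph (I : (\top : con A) x y)).
Qed.

End OneAlgebra.

Lemma preim_image (A B : algebra S) (f : surj_morphism A B) (t : con A) :
  con_preim f (con_image f t) = t `|` con_ker f.
Proof.
apply: con_ext => x y; split=> [[x' [y' [ex ey h]]]|h]; last by exists x, y.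
have /con_leP kj := leUr (con_ker f) t.
by apply: ctrans (kj _ _ _) _; last (apply: ctrans h _; apply: kj);
  rewrite /= ?ex ?ey.
Qed.

Lemma preim_le (A B : algebra S) (f : surj_morphism A B) (u : con B)
    (t : con A) :
  con_preim f u <= t `|` con_ker f <-> u <= con_image f t.
Proof.
rewrite -preim_image; split=> /con_leP h; apply/con_leP => x y; last exact: h.
by have [x' <-] := morph_surj f x; have [y' <-] := morph_surj f y; apply: h.
Qed.

Lemma ker_le_preim (A B : algebra S) (f : surj_morphism A B) (u : con B) :
  con_ker f <= con_preim f u.
Proof.
apply/con_leP => x y e; change (u (f x) (f y)).
by have -> : f x = f y; [exact: e|apply: crefl].
Qed.

Lemma image_in (A B : algebra S) (f : surj_morphism A B) (t : con A) x y :
  (t `|` con_ker f) x y -> con_image f t (f x) (f y).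
Proof. by move=> h; exists x, y. Qed.

(** * The Hagemann-Herrmann commutator satisfies the commutator axioms *)

Section Image.
Context (A B : valgebra V) (f : surj_morphism A B) (a b : con A).
Local Notation k := (con_ker f).
Local Notation fa := (con_image f a).
Local Notation fb := (con_image f b).

Definition graph_map (p : graph (a `|` k)) : graph fa :=
  mkgraph (image_in (svalP p)).

Lemma graph_map_hom : homomorphism graph_map.
Proof. by move=> g ps; apply: graph_ext; exact: morphP. Qed.

Lemma graph_map_surj (q : graph fa) : exists p, graph_map p = q.
Proof.
case: q => [[y y'] [x [x' [e e' h]]]].
by exists (mkgraph h); apply: graph_ext.
Qed.

Definition graph_morph : surj_morphism (graph (a `|` k)) (graph fa) :=
  SurjMorphism graph_map_hom graph_map_surj.

Lemma hh_image_le :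
  hh_commutator (a `|` k) (b `|` k) <= con_preim f (hh_commutator fa fb).
Proof.
apply/con_genP => _ _ [p [q [Dpq epq <- <-]]]; apply: con_gen_in.
exists (graph_map p), (graph_map q); split=> //; last first.
  by change (f (lo p) = f (lo q)); rewrite epq.
suff /con_leP : Delta (a `|` k) (b `|` k) <=
    con_preim graph_morph (Delta fa fb).
  by apply.
apply/DeltaP/con_leP => x y h; apply: con_gen_in; split=> //=.
by exists x, y.
Qed.

(** [Delta] of the images is contained in the image of [Delta] joined with the
    kernel of the induced map on graphs; that kernel lies below d * d as soon as
    the kernel of [f] lies below [d], so [hh_row_join] applies upstairs. *)
Lemma hh_image_ge d : hh_commutator (a `|` k) (b `|` k) <= d -> k <= d ->
  hh_commutator fa fb <= con_image f d.
Proof.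
move=> h kd; apply/con_genP => _ _ [p [q [Dpq epq <- <-]]].
have /con_leP Dle : Delta fa fb <=
    con_image graph_morph (Delta (a `|` k) (b `|` k)).
  apply/DeltaP/con_leP => y y' [x [x' [<- <- bxx']]].
  exists (diag _ x), (diag _ x'); split; try exact: graph_ext.
  by apply: (con_leP _ _ (leUl _ _)); apply: Delta_diag.
have [P [Q [eP eQ PQ]]] := Dle _ _ Dpq.
subst p q; exists (hi P), (hi Q); split=> //.
apply: (con_leP _ _ (leUl _ _)); apply: (hh_row_join h); last first.
  by apply: (con_leP _ _ kd).
move: PQ; apply: (con_leP _ _ _); rewrite leUx leUl /=.
apply: le_trans (leUr _ _); apply/con_leP => x y /= e; apply/con_meetE.
split; apply: (con_leP _ _ kd).
  by have := congr1 (@lo _ _ _ _) e.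
by have := congr1 (@hi _ _ _ _) e.
Qed.

End Image.

Lemma hh_mono (A : valgebra V) (a b b' : con A) : b <= b' ->
  hh_commutator a b <= hh_commutator a b'.
Proof.
move=> bb'; apply/hhP; apply: le_trans (_ : Delta a b' `&` con_lo a \bot <= _).
  by apply: leI2 => //; apply/DeltaP; apply: le_trans bb' _; apply/DeltaP.
exact/hhP.
Qed.

Lemma hh_axioms : commutator_axioms
  (fun (A : valgebra V) (a b : con A) => hh_commutator a b).
Proof.
move=> A B f a b; split; first exact: hh_le.
set k := con_ker f; set d := hh_commutator a b `|` k.
have hd : hh_commutator (a `|` k) (b `|` k) <= d.
  apply: hh_joinr; last exact: leUr.
  by apply: hh_sym; apply: hh_joinr; [apply: hh_sym; exact: leUl|exact: leUr].
apply: le_anti; apply/andP; split.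
  rewrite leUx ker_le_preim andbT.
  apply: le_trans (hh_image_le f a b).
  apply: le_trans (hh_mono _ (leUl b k)) _; apply: hh_sym.
  by apply: le_trans (hh_mono _ (leUl a k)) _; apply: hh_sym.
have kd : k <= d by exact: leUr.
have /preim_le := hh_image_ge hd kd.
by rewrite (join_l kd).
Qed.

(** * The greatest commutator operation and maximal congruences *)

(** The pointwise supremum of all operations satisfying the axioms satisfies
    them too, because images and preimages along a surjection commute with
    suprema above the kernel. *)
Lemma greatest_commutator_exists :
  exists C : con_operation V, is_greatest_commutator C.
Proof.
exists (fun A a b => con_sup
  [set t | exists2 D : con_operation V, commutator_axioms D & t = D A a b]).
split=> [A B f a b|D HD A a b]; last first.
  by have /con_supP := lexx (con_sup
    [set t | exists2 D : con_operation V, commutator_axioms D & t = D A a b]);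
    apply; exists D.
set s := con_sup _; set s' := con_sup _.
have sup_in D : commutator_axioms D -> D A a b <= s.
  by move=> HD; have /con_supP := lexx s; apply; exists D.
have sup_in' D : commutator_axioms D ->
    D B (con_image f a) (con_image f b) <= s'.
  by move=> HD; have /con_supP := lexx s'; apply; exists D.
split; first by apply/con_supP => _ [D HD ->]; have [] := HD A B f a b.
apply: le_anti; apply/andP; split.
  rewrite leUx ker_le_preim andbT.
  apply/con_supP => _ [D HD ->].
  have [_ e] := HD A B f a b; have := leUl (D A a b) (con_ker f).
  rewrite e => /le_trans; apply; apply/con_leP => x y.
  exact: (con_leP _ _ (sup_in' D HD)).
apply/preim_le/con_supP => _ [D HD ->]; apply/preim_le.
by have [_ <-] := HD A B f a b; apply: leU2 => //; apply: sup_in.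
Qed.

Lemma commutator_greatest : is_greatest_commutator (@commutator S V).
Proof.
have h := greatest_commutator_exists.
suff [C HC ->] : exists2 C : con_operation V,
  is_greatest_commutator C & @commutator S V = C by [].
rewrite /commutator; case: pselect => // h'.
by case: (cid h') => C HC /=; exists C.
Qed.

Lemma commutator_top (Vsd : semidegenerate V) (A : valgebra V) :
  commutator (\top : con A) \top = \top.
Proof.
apply: le_anti; rewrite lex1 /= -{1}(hh_top A Vsd).
by have [_] := commutator_greatest; apply; exact: hh_axioms.
Qed.

Definition quot_surj (A : valgebra V) (t : con A) :
    surj_morphism A (quot_valg t) :=
  @SurjMorphism S A (quot_valg t) (quot_class t) (@quot_morph S V A t)
    (fun X => ex_intro _ (quot_rep X) (quot_repK X)).

Lemma ker_quot (A : valgebra V) (t : con A) : con_ker (quot_surj t) = t.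
Proof. by apply: con_ext => x y; exact: iff_sym (quot_classP t x y). Qed.

Lemma commutator_comaximal (Vsd : semidegenerate V) (A : valgebra V)
    (a b m : con A) :
  a `|` m = \top -> b `|` m = \top -> commutator a b `|` m = \top.
Proof.
move=> am bm; have [ax _] := commutator_greatest.
have [_] := ax A (quot_valg m) (quot_surj m) a b; rewrite ker_quot => ->.
have im c : c `|` m = \top -> con_image (quot_surj m) c = \top.
  move=> cm; apply: le_anti; rewrite lex1 /=; apply/preim_le.
  by rewrite ker_quot cm lex1.
rewrite !im // commutator_top //.
by apply: con_ext.
Qed.

Lemma maximal_prime (Vsd : semidegenerate V) (A : valgebra V) (m : con A) :
  m <> \top -> (forall t, m <= t -> t <> \top -> t = m) -> prime_con m.
Proof.
move=> mt mmax; split=> // a b abm.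
apply: contrapT => /not_orP [am bm].
have comax c : ~ c <= m -> c `|` m = \top.
  move=> cm; apply: contrapT => /(mmax _ (leUr _ _)) e.
  by apply: cm; rewrite -e leUl.
have := commutator_comaximal Vsd (comax _ am) (comax _ bm).
by rewrite (join_r abm).
Qed.

End Modular.

(** * Maximal congruences and compactness *)

Section Suprema.
Context (S : signature) (A : algebra S).
Implicit Types (t u v : con A) (F : set (con A)).

Lemma le_con_sup F t : F t -> t <= con_sup F.
Proof. by have /con_supP := lexx (con_sup F); apply. Qed.

Lemma con_sup_mono F G : F `<=` G -> con_sup F <= con_sup G.
Proof. by move=> FG; apply/con_supP => u /FG; exact: le_con_sup. Qed.

(** Zorn's lemma. A chain of proper congruences has a proper supremum: were it
    top, compactness would place top below a finite join of members of the
    chain, hence below one member. *)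
Lemma maximal_above t : compact (\top : con A) -> t <> \top ->
  exists m, [/\ t <= m, m <> \top & forall u, m <= u -> u <> \top -> u = m].
Proof.
move=> ctop tt; pose T := {u : con A | t <= u /\ u <> \top}.
have [||||[m [tm mt]] mmax] := @Zorn T (fun u v : T => sval u <= sval v).
- by move=> u; exact: lexx.
- by move=> u v w; exact: le_trans.
- move=> [u hu] [v hv] /= uv vu; have e : u = v by apply: le_anti; rewrite uv.
  by subst v; congr exist; apply: Prop_irrelevance.
- move=> F Ftot; pose t0 : T := exist _ t (conj (lexx t) tt).
  (* Adding [t] keeps the supremum above [t] when the chain is empty. *)
  pose G := sval @` (t0 |` F).
  have Gtot (u v : T) : (t0 |` F) u -> (t0 |` F) v ->
      sval u <= sval v \/ sval v <= sval u.
    move=> [->|Fu] [->|Fv]; [by left|left|right|exact: Ftot] => /=.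
      by case: (svalP v).
    by case: (svalP u).
  have Gfin (s : seq (con A)) : (forall u, u \in s -> G u) ->
      exists2 v, (t0 |` F) v & \join_(u <- s) u <= sval v.
    elim: s => [_|u s ih h].
      by exists t0; [left|rewrite big_nil le0x].
    have [|v Gv sv] := ih; first by move=> w ws; apply: h; rewrite inE ws orbT.
    have [w Gw wu] := h u (mem_head _ _); rewrite big_cons -wu.
    case: (Gtot _ _ Gv Gw) => vw.
      by exists w => //; rewrite leUx lexx (le_trans sv).
    by exists v => //; rewrite leUx vw.
  have supt : con_sup G <> \top.
    move=> e; have [|s /Gfin [v Gv sv] ts] := ctop G; first by rewrite e.
    have [_] := svalP v; apply; apply: le_anti.
    by rewrite lex1 /= (le_trans ts).
  have tsup : t <= con_sup G by apply: le_con_sup; exists t0 => //; left.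
  exists (exist _ (con_sup G) (conj tsup supt)) => u Fu /=.
  by apply: le_con_sup; exists u => //; right.
exists m; split=> // u mu ut.
by have := mmax (exist _ u (conj (le_trans tm mu) ut)) mu => - [].
Qed.

Definition principal (x y : A) : con A :=
  con_gen (fun x0 y0 => x0 = x /\ y0 = y).

Lemma principal_le x y t : principal x y <= t <-> t x y.
Proof.
by split=> [/con_genP h|h]; [apply: h|apply/con_genP => _ _ [-> ->]].
Qed.

Lemma compact_principal x y : compact (principal x y).
Proof.
move=> F /principal_le /con_sup_finite [s sF sxy].
by exists s => //; apply/principal_le.
Qed.

Lemma le_sup_compact t : t <= con_sup [set c | compact c /\ c <= t].
Proof.
apply/con_leP => x y txy; apply/principal_le/le_con_sup.
by split; [exact: compact_principal|apply/principal_le].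
Qed.

(** For [P] the property of the congruences whose supremum is a residual, this
    turns a finite subcover of top by parts of [t] and of the residual into a
    single compact part of each. *)
Lemma compact_seq_join (P : con A -> Prop) t (s : seq (con A)) :
  P \bot -> (forall u v, P u -> P v -> P (u `|` v)) ->
  (forall u, u \in s -> compact u /\ (u <= t \/ P u)) ->
  exists t' c, [/\ compact t', compact c, t' <= t, P c &
    \join_(u <- s) u <= t' `|` c].
Proof.
move=> P0 PU; elim: s => [_|u s ih h].
  exists \bot, \bot; rewrite big_nil !le0x; split=> //; exact: compact_bot.
have [|t' [c [ct' cc t't Pc sle]]] := ih.
  by move=> v vs; apply: h; rewrite inE vs orbT.
have [cu [ut|Pu]] := h u (mem_head _ _).
  exists (u `|` t'), c; split=> //; first exact: compact_join.
    by rewrite leUx ut.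
  by rewrite big_cons -joinA leU2.
exists t', (u `|` c); split=> //; first exact: compact_join.
  exact: PU.
by rewrite big_cons joinCA leU2.
Qed.

End Suprema.

(** * The operator sigma on ideals of a bounded distributive lattice *)

Section Lattice.
Context (d : Order.disp_t) (L : tbDistrLatticeType d).
Implicit Types (I : set L) (x y z : L).

Lemma sigmaP I x : lattice_ideal I ->
  sigma I x <-> exists y z, [/\ I y, x `&` z = \bot & y `|` z = \top].
Proof.
move=> [I0 Idown IU]; split=> [xI|[y [z [Iy xz yz]]]].
  have : ideal_join I (Ann x) \top by rewrite xI.
  move/(_ [set w | exists y z, [/\ I y, x `&` z = \bot & w <= y `|` z]]).
  case=> [|y Iy|z xz|y [z [Iy xz le1]]].
  - split=> [|v w vw [y [z [Iy xz wyz]]]|v w [y [z [Iy xz vyz]]]].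
    + by exists \bot, \bot; rewrite meetx0 le0x.
    + by exists y, z; rewrite (le_trans vw).
    + move=> [y' [z' [Iy' xz' wyz]]]; exists (y `|` y'), (z `|` z').
      split; [exact: IU|by rewrite meetUr xz xz' joinxx|].
      by rewrite joinACA leU2.
  - by exists y, \bot; rewrite meetx0 leUl.
  - by exists \bot, z; rewrite leUr.
  - by exists y, z; split=> //; apply: le_anti; rewrite lex1.
apply/seteqP; split=> // w _ K [K0 Kdown KU] IK AK.
apply: (Kdown _ \top); first exact: lex1.
by rewrite -yz; apply: KU; [exact: IK|exact: AK].
Qed.

(** x = x /\ (y \/ z) = x /\ y when y \/ z = 1 and x /\ z = 0. *)
Lemma sigma_sub I : lattice_ideal I -> sigma I `<=` I.
Proof.
move=> II x /(sigmaP _ II) [y [z [Iy xz yz]]]; have [_ Idown _] := II.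
apply: Idown Iy; apply/meet_idPl.
by rewrite -[RHS]meetx1 -yz meetUr xz joinx0.
Qed.

(** If (y, z) and (y', z') witness membership of x and x', then
    (y \/ y', z /\ z') witnesses membership of x \/ x'. *)
Lemma sigma_ideal I : lattice_ideal I -> lattice_ideal (sigma I).
Proof.
move=> II; have [I0 Idown IU] := II; split=> [|x x' xx'|x x'].
- by apply/(sigmaP _ II); exists \bot, \top; rewrite meet0x join0x.
- move=> /(sigmaP _ II) [y [z [Iy xz yz]]]; apply/(sigmaP _ II).
  exists y, z; split=> //; apply: le_anti; rewrite le0x andbT -xz.
  exact: leI2.
move=> /(sigmaP _ II) [y [z [Iy xz yz]]] /(sigmaP _ II) [y' [z' [Iy' xz' yz']]].
apply/(sigmaP _ II); exists (y `|` y'), (z `&` z'); split; first exact: IU.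
  by rewrite meetUl meetA xz meet0x join0x [z `&` _]meetC meetA xz' meet0x.
apply: le_anti; rewrite lex1 joinIr /= lexI.
by rewrite joinAC yz join1x -joinA yz' joinx1 !lexx.
Qed.

End Lattice.

(** * The reticulation *)

Section Reticulation.
Context (S : signature) (V : variety S).
Context (Vmod : congruence_modular V) (Vsd : semidegenerate V).
Context (A : valgebra V) (Acl : commutator_closed A).
Implicit Types (t u v : con A) (a b c : compact_con A).

Local Notation L := (reticulation Vsd Acl).
Local Notation lam := (lambda Vsd Acl).

Lemma no_prime_top t : (forall p, prime_con p -> ~ t <= p) -> t = \top.
Proof.
move=> h; apply: contrapT => /(maximal_above (@compact_top _ _ Vsd A)).
move=> [m [tm mt mmax]].
exact: h (maximal_prime Vmod Vsd mt mmax) tm.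
Qed.

Lemma le_rho_bot t : t <= rho \bot <-> forall p, prime_con p -> t <= p.
Proof.
split=> [/con_infP h p pp|h]; first by apply: h; split=> //; exact: le0x.
by apply/con_infP => p [pp _]; exact: h.
Qed.

(** Modulo rho(bottom) the commutator becomes a disjunction at every prime, so
    monotonicity and additivity in each argument hold by logic alone. *)
Lemma commutator_le_rho_bot u v :
  commutator u v <= rho \bot <-> forall p, prime_con p -> u <= p \/ v <= p.
Proof.
apply: (iff_trans (le_rho_bot _)).
by split=> h p pp; apply/(prime_comm _ _ pp); exact: h.
Qed.

(** Compactness of top, applied to the compact congruences below [t] and those
    that occur in the residual. *)
Lemma residual_comaximal t u :
  t `|` residual u (rho \bot) = \top <->
  exists t' c : compact_con A, [/\ (t' : con A) <= t, commutator u c <= rho \bot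
    & (t' : con A) `|` (c : con A) = \top].
Proof.
split=> [e|[t' [c [t't uc e]]]]; last first.
  apply: le_anti; rewrite lex1 /= -e; apply: leU2 => //.
  exact: le_con_sup.
pose P v := commutator u v <= rho \bot.
pose F : set (con A) := [set v | compact v /\ (v <= t \/ P v)].
have tF : t <= con_sup F.
  apply: le_trans (le_sup_compact t) (con_sup_mono _).
  by move=> v [cv vt]; split=> //; left.
have rF : residual u (rho \bot) <= con_sup F.
  apply/con_supP => v Pv; apply: le_trans (le_sup_compact v) (con_sup_mono _).
  move=> w [cw wv]; split=> //; right.
  apply/commutator_le_rho_bot => p pp.
  have /commutator_le_rho_bot/(_ p pp) [|vp] := Pv; first by left.
  by right; exact: le_trans wv vp.
have [|s sF le1] := @compact_top _ _ Vsd A F; first by rewrite -e leUx tF.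
have [|||t' [c [ct' cc t't Pc sle]]] := @compact_seq_join _ _ P t s.
- by apply/commutator_le_rho_bot => p pp; right; exact: le0x.
- move=> v w /commutator_le_rho_bot Pv /commutator_le_rho_bot Pw.
  apply/commutator_le_rho_bot => p pp; rewrite leUx.
  case: (Pv p pp) => [|->]; first by left.
  by case: (Pw p pp) => [|->]; [left|right].
- exact: sF.
exists (mk_compact ct'), (mk_compact cc); split=> //=.
by apply: le_anti; rewrite lex1 /= (le_trans le1).
Qed.

(** lambda(a) = 1 says that no prime congruence contains [a]; there are enough
    primes for this to force [a] to be top. *)
Lemma lambda_top a : lam a = \top <-> (a : con A) = \top.
Proof.
split=> [/lambdaP e|e]; last by apply/lambdaP => /=; rewrite e.
apply: no_prime_top => p pp ap; have [pt _] := pp.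
have /rho_leP/(_ p pp ap) /= : rho (\top : con A) <= rho a by rewrite e.
by rewrite le1x => /eqP.
Qed.

Lemma lambda_meet_bot a b :
  lam a `&` lam b = \bot <-> commutator (a : con A) b <= rho \bot.
Proof.
rewrite lambda_comm; split=> [/lambdaP/= e|h]; last first.
  apply/lambdaP/le_anti/andP; split; apply/rho_leP => p pp _ /=.
    by move/le_rho_bot: h; apply.
  exact: le0x.
apply/le_rho_bot => p pp.
have /rho_leP/(_ p pp (le0x p)) // : rho (commutator (a : con A) b) <= rho \bot.
by rewrite e.
Qed.

Lemma lambda_le a b : (a : con A) <= b -> lam a <= lam b.
Proof.
move=> ab; apply/join_idPl; rewrite lambda_join; apply/lambdaP => /=.
by rewrite (join_l ab).
Qed.

Lemma upper_star_ideal t : lattice_ideal (upper_star Vsd Acl t).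
Proof.
split=> [|x y xy [b bt e]|_ _ [a at' <-] [b bt <-]].
- by exists (mk_compact (@compact_bot S A)) => //=; exact: le0x.
- exists (mk_compact (Acl (compact_conP (lrepr x)) (compact_conP b))).
    apply: le_trans bt; apply: le_trans (commutator_le _ _) (leIr _ _).
  by rewrite -lambda_comm e lreprK; apply/meet_idPl.
rewrite lambda_join.
exists (mk_compact (compact_join (compact_conP a) (compact_conP b))) => //=.
by rewrite leUx at'.
Qed.

(** A compact congruence below a supremum of generators lies below a finite join
    of them, and [lambda] turns that join into a join in the ideal. *)
Lemma ideal_sup_closed (J : set L) (F : set (con A)) a :
  lattice_ideal J ->
  (forall u, F u -> exists2 b : compact_con A, u = b & J (lam b)) ->
  (a : con A) <= con_sup F -> J (lam a).
Proof.
move=> [J0 Jdown JU] FJ /(compact_conP a) [s sF le_as].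
have [b sb Jb] : exists2 b : compact_con A,
    \join_(u <- s) u <= (b : con A) & J (lam b).
  elim: s sF {le_as} => [_|u s ih sF].
    by exists (mk_compact (@compact_bot S A)); rewrite ?big_nil ?le0x.
  have [|b sb Jb] := ih; first by move=> v vs; apply: sF; rewrite inE vs orbT.
  have [c -> Jc] := FJ u (sF u (mem_head _ _)).
  exists (mk_compact (compact_join (compact_conP c) (compact_conP b))).
    by rewrite big_cons /= leU2.
  by rewrite -lambda_join; exact: JU.
by apply: Jdown Jb; apply: lambda_le; exact: le_trans le_as sb.
Qed.

(** The bridge between the two sides: the condition on generators in [Kert] is
    membership in sigma of the associated ideal. *)
Lemma sigma_upper_star t a :
  sigma (upper_star Vsd Acl t) (lam a) <->
  t `|` residual a (rho \bot) = \top.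
Proof.
apply: (iff_trans (sigmaP _ (upper_star_ideal t))).
apply: iff_trans (iff_sym (residual_comaximal t a)).
split=> [[_ [z [[t' t't <-] az yz]]]|[t' [c [t't ac e]]]].
  exists t', (lrepr z); split=> //.
    by apply/lambda_meet_bot; rewrite lreprK.
  apply/(lambda_top (mk_compact
    (compact_join (compact_conP t') (compact_conP (lrepr z))))).
  by rewrite -lambda_join lreprK.
exists (lam t'), (lam c); split; first by exists t'.
  exact/lambda_meet_bot.
by rewrite lambda_join; apply/lambda_top.
Qed.

Lemma upper_lower_star (I : set L) : lattice_ideal I ->
  upper_star Vsd Acl (lower_star I) = I.
Proof.
move=> II; apply/seteqP; split=> [_ [a aI <-]|x Ix].
  by apply: ideal_sup_closed II _ aI => _ [b Ib <-]; exists b.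
exists (lrepr x); last exact: lreprK.
by apply: le_con_sup; exists (lrepr x) => //=; rewrite lreprK.
Qed.

Lemma upper_star_Kert t :
  upper_star Vsd Acl (Kert t) = sigma (upper_star Vsd Acl t).
Proof.
apply/seteqP; split=> [_ [a aK <-]|x xs].
  apply: ideal_sup_closed (sigma_ideal (upper_star_ideal t)) _ aK.
  by move=> u [cu e]; exists (mk_compact cu) => //; apply/sigma_upper_star.
exists (lrepr x); last exact: lreprK.
apply: le_con_sup; split; first exact: compact_conP.
by apply/sigma_upper_star; rewrite lreprK.
Qed.

Lemma lower_star_sigma (I : set L) : lattice_ideal I ->
  lower_star (sigma I) = Kert (lower_star I).
Proof.
move=> II; rewrite -{1}(upper_lower_star II); congr con_sup.
apply/seteqP; split=> [_ [a /sigma_upper_star e <-]|u [cu e]].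
  by split=> //; exact: compact_conP.
by exists (mk_compact cu) => //; apply/sigma_upper_star.
Qed.

(** [Ker] asks its generators to lie below [t], which a representative [a] of a
    member of sigma need not do. If b <= t, b \/ c = top and
    [a, c] <= rho(bottom), then [a, b] lies below [t] and
    lambda([a, b]) = lambda(a) /\ lambda(b) = lambda(a). *)
Lemma upper_star_Ker t : semiprime A ->
  upper_star Vsd Acl (Ker t) = sigma (upper_star Vsd Acl t).
Proof.
move=> Asp; rewrite /Ker /annihilator -Asp.
apply/seteqP; split=> [x|x xs].
  rewrite -upper_star_Kert => -[a aK <-]; exists a => //=.
  apply: le_trans aK (con_sup_mono _).
  by move=> u [cu _ e].
pose a := lrepr x.
have /residual_comaximal [t' [c [t't ac e]]] :
    t `|` residual a (rho \bot) = \top.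
  by apply/sigma_upper_star; rewrite lreprK.
pose a' := mk_compact (Acl (compact_conP a) (compact_conP t')).
have ea' : lam a' = x.
  rewrite -lambda_comm -[RHS](lreprK x) -[RHS]meetx1.
  have -> : \top = lam t' `|` lam c.
    by apply/esym; rewrite lambda_join; apply/lambda_top.
  have /lambda_meet_bot ac0 := ac.
  by rewrite meetUr -/a ac0 joinx0.
exists a' => //; apply: le_con_sup; split; first exact: compact_conP.
  by apply: le_trans t't; apply: le_trans (commutator_le _ _) (leIr _ _).
by apply/sigma_upper_star; rewrite ea'.
Qed.

(** Here the requirement on generators of [Ker] is automatic, since sigma(I) is
    contained in I. *)
Lemma lower_star_sigma_semiprime (I : set L) : semiprime A -> lattice_ideal I ->
  lower_star (sigma I) = Ker (lower_star I).
Proof.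
move=> Asp II; rewrite /Ker /annihilator -Asp; congr con_sup.
apply/seteqP; split=> [_ [a aI <-]|u [cu _ e]].
  split; first exact: compact_conP.
    by apply: le_con_sup; exists a => //; exact: (sigma_sub II).
  by apply/sigma_upper_star; rewrite upper_lower_star.
exists (mk_compact cu) => //=.
by rewrite -(upper_lower_star II); apply/sigma_upper_star.
Qed.

End Reticulation.

Theorem theorem5p5 (S : signature) (V : variety S)
    (Vmod : congruence_modular V) (Vsd : semidegenerate V)
    (A : valgebra V) (Acl : commutator_closed A) :
  (forall t : con A,
     upper_star Vsd Acl (Kert t) = sigma (upper_star Vsd Acl t)) /\
  (forall I : set (reticulation Vsd Acl), lattice_ideal I ->
     lower_star (sigma I) = Kert (lower_star I)) /\
  (semiprime A ->
     forall (t : con A) (I : set (reticulation Vsd Acl)), lattice_ideal I ->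
       upper_star Vsd Acl (Ker t) = sigma (upper_star Vsd Acl t) /\
       lower_star (sigma I) = Ker (lower_star I)).
Proof.
split; first exact: upper_star_Kert.
split; first exact: lower_star_sigma.
move=> Asp t I II; split; first exact: upper_star_Ker.
exact: lower_star_sigma_semiprime.
Qed.
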